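(* Let $m\in\mathbb{N}$, $m\ge1$, let $A\subseteq\mathbb{N}^m$ be a finite non-empty complete set of multi-indices, and let $P_A=\{p_\alpha\}_{\alpha\in A}\subseteq\mathbb{R}^m$ be a set of nodes (pairwise distinct, indexed by $A$) that is unisolvent with respect to $\Pi_A$. Let $L_\alpha\in\Pi_A$, $\alpha\in A$, be the multivariate Lagrange polynomials, defined by $L_\alpha(p_\beta)=\delta_{\alpha,\beta}$ for all $\alpha,\beta\in A$. Then: (i) The Lagrange polynomials $L_\alpha\in\Pi_A$, $\alpha\in A$, are a basis of $\Pi_A$. (ii) For every function $f:\mathbb{R}^m\to\mathbb{R}$, the polynomial $Q_{f,A}(x)=\sum_{\alpha\in A}f(p_\alpha)L_\alpha(x)\in\Pi_A$ is the unique polynomial in $\Pi_A$ interpolating $f$ on $P_A$ (i.e. $Q_{f,A}(p)=f(p)$ for all $p\in P_A$), and it can be determined in $\mathcal{O}(|A|)$ operations.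
   Context: $\mathbb{N}$ contains $0$ when used for multi-indices. $\Pi_A=\mathrm{span}\{x^\alpha:\alpha\in A\}$ is the space of real polynomials in $x_1,\dots,x_m$ spanned by the monomials $x^\alpha=x_1^{\alpha_1}\cdots x_m^{\alpha_m}$, $\alpha\in A$. $A$ is complete (downward closed) if $\alpha\in A$, $\beta\in\mathbb{N}^m$ and $\beta_i\le\alpha_i$ for all $i$ imply $\beta\in A$. A finite non-empty set $P\subseteq\mathbb{R}^m$ is unisolvent with respect to a polynomial subspace $\Pi$ if there is no $Q\in\Pi\setminus\{0\}$ with $Q(p)=0$ for all $p\in P$. $\delta_{\alpha,\beta}$ is the Kronecker delta. ''Determined'' means that the coefficients of $Q_{f,A}$ in the Lagrange basis are obtained, an evaluation of $f$ at a node counting as one operation. *)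

(* Defs.v *)
From HB Require Import structures.
From mathcomp Require Import all_boot all_order all_algebra.
From mathcomp Require Import finmap mpoly reals.

Set Implicit Arguments.
Unset Strict Implicit.
Unset Printing Implicit Defensive.

Import GRing.Theory Num.Theory.

Local Open Scope fset_scope.
Local Open Scope ring_scope.

(* {mpoly R[m]} is infinite dimensional, hence not a vectType; subspaces are
   Prop-valued predicates on an arbitrary lmodType. *)
Definition in_span (R : nzRingType) (V : lmodType R) (I : finType)
    (v : I -> V) (x : V) : Prop :=
  exists c : I -> R, x = \sum_(i : I) c i *: v i.

Definition lin_indep (R : nzRingType) (V : lmodType R) (I : finType)
    (v : I -> V) : Prop :=
  forall c : I -> R, \sum_(i : I) c i *: v i = 0 -> forall i, c i = 0.

Definition is_basis (R : nzRingType) (V : lmodType R) (I : finType)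
    (W : V -> Prop) (v : I -> V) : Prop :=
  [/\ forall i, W (v i), lin_indep v & forall x, W x -> in_span v x].

Definition complete (m : nat) (A : {fset 'X_{1..m}}) : Prop :=
  forall a b : 'X_{1..m}, a \in A -> (forall i, (b i <= a i)%N) -> b \in A.

Definition Pi (R : realType) (m : nat) (A : {fset 'X_{1..m}}) :
    {mpoly R[m]} -> Prop :=
  in_span (fun a : A => 'X_[val a] : {mpoly R[m]}).

Definition peval (R : realType) (m : nat) (Q : {mpoly R[m]})
    (x : 'rV[R]_m) : R := Q.@[fun i => x 0 i].

Definition unisolvent (R : realType) (m : nat) (P : {fset 'rV[R]_m})
    (W : {mpoly R[m]} -> Prop) : Prop :=
  P != fset0 /\
  ~ exists Q, [/\ W Q, Q != 0 & forall x, x \in P -> peval Q x = 0].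

Definition node_set (R : realType) (m : nat) (A : {fset 'X_{1..m}})
    (p : A -> 'rV[R]_m) : {fset 'rV[R]_m} := [fset p a | a : A].

Definition is_lagrange (R : realType) (m : nat) (A : {fset 'X_{1..m}})
    (p : A -> 'rV[R]_m) (L : A -> {mpoly R[m]}) : Prop :=
  (forall a, Pi A (L a)) /\ (forall a b, peval (L a) (p b) = (a == b)%:R).

Definition interpolates (R : realType) (m : nat) (P : {fset 'rV[R]_m})
    (f : 'rV[R]_m -> R) (Q : {mpoly R[m]}) : Prop :=
  forall x, x \in P -> peval Q x = f x.

Definition interpolant (R : realType) (m : nat) (A : {fset 'X_{1..m}})
    (p : A -> 'rV[R]_m) (L : A -> {mpoly R[m]}) (f : 'rV[R]_m -> R) :
    {mpoly R[m]} := \sum_(a : A) f (p a) *: L a.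

(* Cost model: straight-line programs over the reals with an oracle.  Every
   instruction appends one value to the list of registers and costs one
   operation; [OEval a] queries the value of f at the node p a.  Reading a
   register that is not yet defined gives 0, and x / 0 = 0. *)
Inductive instr (R I : Type) : Type :=
| OConst of R
| OEval of I
| OAdd of nat & nat
| OSub of nat & nat
| OMul of nat & nat
| ODiv of nat & nat.

Definition instr_val (R : realType) (I : Type) (oracle : I -> R)
    (s : seq R) (op : instr R I) : R :=
  match op with
  | OConst c => c
  | OEval i => oracle i
  | OAdd j k => s`_j + s`_k
  | OSub j k => s`_j - s`_k
  | OMul j k => s`_j * s`_k
  | ODiv j k => s`_j / s`_k
  end.

Definition run (R : realType) (I : Type) (oracle : I -> R)
    (prog : seq (instr R I)) : seq R :=
  foldl (fun s op => rcons s (instr_val oracle s op)) [::] prog.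

(* One program of at most N instructions, not depending on f, computes for
   every f the coefficients of the interpolant of f in the family L.  The
   output register [out a] ranges over the registers that [prog] fills, so
   that no coefficient is obtained for free. *)
Definition determined_within (R : realType) (m : nat) (A : {fset 'X_{1..m}})
    (p : A -> 'rV[R]_m) (L : A -> {mpoly R[m]}) (N : nat) : Prop :=
  exists (prog : seq (instr R A)) (out : A -> 'I_(size prog)),
    (size prog <= N)%N /\
    forall f : 'rV[R]_m -> R,
      interpolant p L f =
        \sum_(a : A) (run (fun b => f (p b)) prog)`_(out a) *: L a.

(* Main.v *)
(** Unisolvence says that the evaluation map Q |-> (Q(p_a))_a is injective on
    Pi_A; since dim Pi_A = |A|, it is bijective, and the Lagrange polynomials
    are the preimages of the unit vectors. Hence the Lagrange coefficients of
    the interpolant are the node values themselves, and the program that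
    queries each node once computes them in |A| operations. *)
Require Import Defs.
From HB Require Import structures.
From mathcomp Require Import all_boot all_order all_algebra.
From mathcomp Require Import finmap mpoly reals.
From mathcomp Require boolp.

Set Implicit Arguments.
Unset Strict Implicit.
Unset Printing Implicit Defensive.

Import GRing.Theory Num.Theory.

Local Open Scope fset_scope.
Local Open Scope ring_scope.

Section Spans.

Variables (R : nzRingType) (V : lmodType R) (I : finType) (v : I -> V).

Lemma in_span_sum (J : finType) (c : J -> R) (w : J -> V) :
  (forall j, in_span v (w j)) -> in_span v (\sum_j c j *: w j).
Proof.
(* Choice selects coordinates [d j] of each [w j]; swapping the two sums collects the coefficient of
   each [v i]. *)
move=> /boolp.choice [d wE]; exists (fun i => \sum_j c j * d j i).
under [RHS]eq_bigr => i _ do rewrite scaler_suml.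
rewrite exchange_big /=; apply: eq_bigr => j _.
by rewrite wE scaler_sumr; apply: eq_bigr => i _; rewrite scalerA.
Qed.

Lemma in_spanB x y : in_span v x -> in_span v y -> in_span v (x - y).
Proof.
move=> [c ->] [d ->]; exists (fun i => c i - d i).
by rewrite -sumrB; apply: eq_bigr => i _; rewrite scalerBl.
Qed.

End Spans.

(** Distinct indices give distinct monomials, so [mcoeff (val a)] isolates [c a]. *)
Lemma mpolyX_lin_indep (R : nzRingType) (m : nat) (A : {fset 'X_{1..m}}) :
  lin_indep (fun a : A => 'X_[val a] : {mpoly R[m]}).
Proof.
move=> c c0 a; have := congr1 (mcoeff (val a)) c0.
rewrite mcoeff0 raddf_sum /= (bigD1 a) //= mcoeffZ mcoeffX eqxx mulr1.
rewrite big1 ?addr0 // => b ba.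
by rewrite mcoeffZ mcoeffX (inj_eq val_inj) (negbTE ba) mulr0.
Qed.

Lemma peval_sum (R : realType) (m : nat) (I : finType) (c : I -> R)
    (Q : I -> {mpoly R[m]}) (x : 'rV[R]_m) :
  peval (\sum_i c i *: Q i) x = \sum_i c i * peval (Q i) x.
Proof. by rewrite /peval raddf_sum; apply: eq_bigr => i _; exact: mevalZ. Qed.

Lemma run_OEval (R : realType) (I : Type) (oracle : I -> R) (s : seq I) :
  run oracle [seq OEval R i | i <- s] = map oracle s.
Proof.
elim/last_ind: s => // s i IHs.
by rewrite /run map_rcons -cats1 foldl_cat -/(run _ _) IHs /= map_rcons.
Qed.

Section Interpolation.

Variables (R : realType) (m : nat) (A : {fset 'X_{1..m}}).
Variable p : A -> 'rV[R]_m.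

Lemma determined_within_evals (L : A -> {mpoly R[m]}) :
  determined_within p L #|` A|.
Proof.
pose prog := [seq OEval R a | a <- enum {: A}].
have szprog : size prog = #|{: A}| by rewrite size_map cardE.
(* One query per node in enumeration order, so the value at [p a] sits in the register numbered by
   the rank of [a]. *)
exists prog, (fun a => cast_ord (esym szprog) (enum_rank a)).
split=> [|f]; first by rewrite szprog cardfE.
apply: eq_bigr => a _; congr (_ *: _).
rewrite run_OEval (nth_map a) /=; last by rewrite -cardE ltn_ord.
by rewrite nth_enum_rank.
Qed.

Lemma interpolates_node_set (f : 'rV[R]_m -> R) (Q : {mpoly R[m]}) :
  interpolates (node_set p) f Q <-> forall a, peval Q (p a) = f (p a).
Proof.
split=> [Qf a|Qf _ /imfsetP[a _ ->] //]; apply: Qf.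
exact: in_imfset.
Qed.

Section Lagrange.

Variable L : A -> {mpoly R[m]}.
Hypothesis lagL : is_lagrange p L.

(** Evaluations at the nodes are dual to [L]. This yields both independence of [L] and the
    interpolation property. *)
Lemma peval_lagrange_sum (c : A -> R) b :
  peval (\sum_a c a *: L a) (p b) = c b.
Proof.
rewrite peval_sum (bigD1 b) //= lagL.2 eqxx mulr1 big1 ?addr0 // => a ab.
by rewrite lagL.2 (negbTE ab) mulr0.
Qed.

Lemma lagrange_lin_indep : lin_indep L.
Proof.
by move=> c c0 a; rewrite -(peval_lagrange_sum c) c0 /peval meval0.
Qed.

Lemma Pi_lagrange_sum (c : A -> R) : Pi A (\sum_a c a *: L a).
Proof. exact/in_span_sum/lagL.1. Qed.

End Lagrange.

Hypothesis uniA : unisolvent (node_set p) (@Pi R m A).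

(** The difference lies in [Pi A] and vanishes on the nodes, so unisolvence forces it to be zero. *)
Lemma Pi_eq_on_nodes (Q1 Q2 : {mpoly R[m]}) : Pi A Q1 -> Pi A Q2 ->
  (forall a, peval Q1 (p a) = peval Q2 (p a)) -> Q1 = Q2.
Proof.
move=> Q1A Q2A Q12; apply/eqP; rewrite -subr_eq0; apply: boolp.contrapT => /negP nz.
apply: uniA.2; exists (Q1 - Q2); split=> //; first exact: in_spanB.
move=> _ /imfsetP[a _ ->].
by rewrite /peval mevalB; apply/eqP; rewrite subr_eq0; apply/eqP/Q12.
Qed.

(** Both sides lie in [Pi A] and agree at every node. This provides spanning as well as uniqueness
    of the interpolant. *)
Lemma lagrange_expansion (L : A -> {mpoly R[m]}) (Q : {mpoly R[m]}) :
  is_lagrange p L -> Pi A Q -> Q = \sum_a peval Q (p a) *: L a.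
Proof.
move=> lagL QA; apply: Pi_eq_on_nodes => // [|a].
  exact: Pi_lagrange_sum lagL _.
by rewrite peval_lagrange_sum.
Qed.

Lemma lagrange_unique (L1 L2 : A -> {mpoly R[m]}) :
  is_lagrange p L1 -> is_lagrange p L2 -> L1 = L2.
Proof.
move=> [L1A L1p] [L2A L2p]; apply: boolp.funext => a.
by apply: Pi_eq_on_nodes => // b; rewrite L1p L2p.
Qed.

(* Unisolvence makes the generalized Vandermonde matrix [M] invertible, and row
   [a] of its inverse lists the coefficients of [L a]. *)
Lemma lagrange_exists : exists L : A -> {mpoly R[m]}, is_lagrange p L.
Proof.
pose X (i : 'I_#|{: A}|) : {mpoly R[m]} := 'X_[val (enum_val i)].
pose M : 'M[R]_#|{: A}| := \matrix_(i, j) peval (X i) (p (enum_val j)).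
have enum_sum (c : 'I_#|{: A}| -> R) : \sum_i c i *: X i =
    \sum_(a : A) c (enum_rank a) *: 'X_[val a] :> {mpoly R[m]}.
  rewrite [RHS](reindex _ (onW_bij _ (enum_val_bij A))) /=.
  by apply: eq_bigr => i _; rewrite enum_valK.
have spanX (c : 'I_#|{: A}| -> R) : Pi A (\sum_i c i *: X i).
  by rewrite enum_sum; exists (fun a => c (enum_rank a)).
(* Multiplying a coefficient row by [M] evaluates the corresponding polynomial at all nodes. *)
have mulM k (c : 'M[R]_(k, _)) i b :
    (c *m M) i (enum_rank b) = peval (\sum_j c i j *: X j) (p b).
  by rewrite mxE peval_sum; apply: eq_bigr => j _; rewrite mxE enum_rankK.
(* A row killed by [M] is a polynomial vanishing on the nodes, hence zero; independence of monomials
   then kills the row. *)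
have unitM : M \in unitmx.
  rewrite -row_free_unit; apply: inj_row_free => c cM0.
  have Q0 : \sum_j c 0 j *: X j = 0.
    apply: Pi_eq_on_nodes => // [|b].
      rewrite -(subrr (\sum_j c 0 j *: X j)).
      exact: in_spanB (spanX _) (spanX _).
    by rewrite -mulM cM0 mxE /peval meval0.
  apply/rowP => j; rewrite mxE -(enum_valK j).
  apply: (mpolyX_lin_indep (c := fun a => c 0 (enum_rank a))).
  by rewrite -enum_sum.
exists (fun a => \sum_j invmx M (enum_rank a) j *: X j); split=> // a b.
by rewrite -mulM mulVmx // mxE (inj_eq enum_rank_inj).
Qed.

End Interpolation.

Theorem corollary4p2 (R : realType) :
  exists C : nat,
  forall (m : nat) (A : {fset 'X_{1..m}}) (p : A -> 'rV[R]_m),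
    (1 <= m)%N -> A != fset0 -> complete A ->
    injective p -> unisolvent (node_set p) (@Pi R m A) ->
    (exists! L : A -> {mpoly R[m]}, is_lagrange p L) /\
    (forall L : A -> {mpoly R[m]}, is_lagrange p L ->
       is_basis (@Pi R m A) L /\
       (forall f : 'rV[R]_m -> R,
          unique (fun Q => Pi A Q /\ interpolates (node_set p) f Q)
                 (interpolant p L f)) /\
       determined_within p L (C * #|` A|)).
Proof.
exists 1%N => m A p _ _ _ _ uniA; split.
  have [L lagL] := lagrange_exists uniA.
  by exists L; split=> // L'; exact: (lagrange_unique uniA).
move=> L lagL; rewrite mul1n; split; last first.
  split; last exact: determined_within_evals.
  move=> f; split.
    split; first exact: Pi_lagrange_sum lagL _.
    by apply/interpolates_node_set => a; exact: peval_lagrange_sum lagL _ _.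
  move=> Q [QA /interpolates_node_set Qf].
  (* The Lagrange coefficients of any interpolant [Q] are its node values, which are those of
     [f]. *)
  rewrite [RHS](lagrange_expansion uniA lagL QA).
  by apply: eq_bigr => a _; rewrite Qf.
split; [exact: lagL.1 | exact: lagrange_lin_indep lagL |].
by move=> Q QA; exists (fun a => peval Q (p a)); exact: lagrange_expansion.
Qed.
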